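(* Let $R$ be a ring and $\alpha$ an automorphism of $R$ such that $R$ is SPA (skew power-serieswise Armendariz, with respect to $\alpha$). Then the following are equivalent: (1) $R$ is nil-reversible. (2) $R[x;\alpha]$ is nil-reversible. (3) $R[x,x^{-1};\alpha]$ is nil-reversible. (4) $R[[x;\alpha]]$ is nil-reversible. (5) $R[[x,x^{-1};\alpha]]$ is nil-reversible.
   Context: All rings are associative with identity. For a ring $R$, $N(R)$ denotes the set of all nilpotent elements of $R$. For $a\in R$, $l(a)=\{x\in R: xa=0\}$ and $r(a)=\{x\in R: ax=0\}$. A ring $R$ is nil-reversible if $l(a)=r(a)$ for every $a\in N(R)$. For an endomorphism $\alpha$ of $R$: $R[x;\alpha]$ is the skew polynomial ring, with elements $\sum_{i=0}^n w_ix^i$ ($w_i\in R$), usual addition, and multiplication determined by $xw=\alpha(w)x$ for $w\in R$; $R[x,x^{-1};\alpha]$ is the skew Laurent polynomial ring, whose elements are finite sums of elements $x^{-i}wx^j$ with $w\in R$ and $i,j\ge 0$; $R[[x;\alpha]]$ is the skew power series ring, with elements $\sum_{i=0}^{\infty}w_ix^i$ and the same multiplication rule; $R[[x,x^{-1};\alpha]]$ is the skew Laurent power series ring, the localization of $R[[x;\alpha]]$ with respect to $\{x^i\}_{i\ge 0}$. When $\alpha$ is an automorphism, the elements of $R[[x,x^{-1};\alpha]]$ have the form $x^pw_p+x^{p+1}w_{p+1}+\cdots+w_0+w_1x+\cdots$ with $w_j\in R$ and $p\le 0$ an integer, with usual addition and multiplication determined by $xw=\alpha(w)x$. $R$ is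 skew power-serieswise Armendariz (SPA) if for all $g(x)=\sum_{i=0}^{\infty}w_ix^i$ and $h(x)=\sum_{j=0}^{\infty}h_jx^j$ in $R[[x;\alpha]]$, $g(x)h(x)=0$ if and only if $w_ih_j=0$ for all $i,j$. *)

(* Defs.v *)
From HB Require Import structures.
From mathcomp Require Import all_boot all_order all_algebra.
From mathcomp Require Import boolp classical_sets functions cardinality fsbigop.
From mathcomp Require Import zify.

Set Implicit Arguments.
Unset Strict Implicit.
Unset Printing Implicit Defensive.

Import Order.TTheory GRing.Theory Num.Theory.
Local Open Scope classical_set_scope.
Local Open Scope ring_scope.

(* Rings are pzRingType's: associative, with 1, not necessarily commutative,  *)
(* the zero ring being allowed.                                               *)

Section NilReversible.
Variable A : pzRingType.

Definition nilpotents : set A := [set a | exists n : nat, a ^+ n = 0].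
Definition lann (a : A) : set A := [set x | x * a = 0].
Definition rann (a : A) : set A := [set x | a * x = 0].

End NilReversible.

Definition nil_reversible (A : pzRingType) : Prop :=
  forall a : A, nilpotents a -> lann a = rann a.

(* R[[x; alpha]]: f stands for \sum_i (f i) x^i.                              *)
Record skew_series (R : pzRingType) (alpha : {rmorphism R -> R}) :=
  SkewSeries { scoef :> nat -> R }.

Section SkewSeries.
Variables (R : pzRingType) (alpha : {rmorphism R -> R}).
Local Notation T := (skew_series alpha).
Implicit Types (f g h : T) (a b : R).

HB.instance Definition _ := gen_eqMixin T.
HB.instance Definition _ := gen_choiceMixin T.

Lemma skew_seriesP f g : f =1 g -> f = g.
Proof. by case: f g => [f] [g] /= /funext ->. Qed.

Definition ss_zero : T := SkewSeries alpha (fun=> 0).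
Definition ss_opp f : T := SkewSeries alpha (fun n => - f n).
Definition ss_add f g : T := SkewSeries alpha (fun n => f n + g n).
Definition ss_monom a (i : nat) : T :=
  SkewSeries alpha (fun n => if n == i then a else 0).
(* (a x^i) (b x^j) = a alpha^i(b) x^(i + j)                                   *)
Definition ss_mul f g : T :=
  SkewSeries alpha
    (fun n => \sum_(i < n.+1) f i * iter i alpha (g (n - i)%N)).

Fact iter_rmorphB i : additive (iter i alpha).
Proof. by elim: i => // i IH x y; rewrite /= IH rmorphB. Qed.
Fact iter_rmorphM i : monoid_morphism (iter i alpha).
Proof.
elim: i => // i [IH1 IHM]; split=> [|x y] /=; first by rewrite IH1 rmorph1.
by rewrite IHM rmorphM.
Qed.
HB.instance Definition _ i :=
  GRing.isZmodMorphism.Build R R (iter i alpha) (@iter_rmorphB i).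
HB.instance Definition _ i :=
  GRing.isMonoidMorphism.Build R R (iter i alpha) (@iter_rmorphM i).

Fact ss_addA : associative ss_add.
Proof. by move=> f g h; apply: skew_seriesP => n /=; rewrite addrA. Qed.
Fact ss_addC : commutative ss_add.
Proof. by move=> f g; apply: skew_seriesP => n /=; rewrite addrC. Qed.
Fact ss_add0 : left_id ss_zero ss_add.
Proof. by move=> f; apply: skew_seriesP => n /=; rewrite add0r. Qed.
Fact ss_addN : left_inverse ss_zero ss_opp ss_add.
Proof. by move=> f; apply: skew_seriesP => n /=; rewrite addNr. Qed.

Fact ss_mulA : associative ss_mul.
Proof.
move=> f g h; apply: skew_seriesP => n /=.
pose F i j := f i * iter i alpha (g j) * iter (i + j)%N alpha (h (n - (i + j))%N).
transitivity (\sum_(i < n.+1) \sum_(j < n.+1 | (i + j < n.+1)%N) F i j).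
  apply: eq_bigr => -[i ltin] _ /=.
  rewrite rmorph_sum mulr_sumr.
  rewrite (big_ord_widen n.+1 (fun j => f i *
    iter i alpha (g j * iter j alpha (h (n - i - j)%N)))); last by lia.
  apply: eq_big => [j|j _]; first by lia.
  by rewrite /F rmorphM mulrA iterD subnDA.
transitivity (\sum_(i < n.+1) \sum_(k < n.+1 | (i <= k)%N) F i (k - i)%N).
  apply: eq_bigr => -[i ltin] _ /=.
  rewrite -(big_mkord (fun j => (i + j < n.+1)%N) (F i)).
  rewrite -(big_mkord (fun k => (i <= k)%N) (fun k => F i (k - i)%N)).
  rewrite [RHS](big_cat_nat (n := i)) //=; last by lia.
  rewrite [X in _ = X + _]big_nat_cond [X in _ = X + _]big1 ?add0r; last first.
    by move=> k kP; exfalso; lia.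
  rewrite -[X in _ = \sum_(X <= _ < _ | _) _]add0n big_addn.
  rewrite [LHS](big_cat_nat (n := (n.+1 - i)%N)) //=; last by lia.
  rewrite [X in _ + X]big_nat_cond [X in _ + X]big1 ?addr0; last first.
    by move=> k kP; exfalso; lia.
  rewrite big_nat_cond [RHS]big_nat_cond.
  by apply: eq_big => [k|k _]; [lia | rewrite addnK].
rewrite (exchange_big_dep predT) //=.
apply: eq_bigr => -[k ltkn] _ /=.
rewrite mulr_suml (big_ord_widen n.+1 (fun i =>
  f i * iter i alpha (g (k - i)%N) * iter k alpha (h (n - k)%N))); last by lia.
by apply: eq_big => [i|i lik]; [lia | rewrite /F subnKC].
Qed.

Fact ss_mul1l : left_id (ss_monom 1 0) ss_mul.
Proof.
move=> f; apply: skew_seriesP => n /=.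
rewrite big_ord_recl big1 => [|i _] /=; last by rewrite mul0r.
by rewrite mul1r addr0 subn0.
Qed.
Fact ss_mul1r : right_id (ss_monom 1 0) ss_mul.
Proof.
move=> f; apply: skew_seriesP => n /=.
rewrite big_ord_recr big1 => [|i _] /=; last first.
  by rewrite subn_eq0 leqNgt ltn_ord raddf0 mulr0.
by rewrite subnn eqxx rmorph1 mulr1 add0r.
Qed.
Fact ss_mulDl : left_distributive ss_mul ss_add.
Proof.
move=> f g h; apply: skew_seriesP => n /=.
by rewrite -big_split; apply: eq_bigr => i _; rewrite mulrDl.
Qed.
Fact ss_mulDr : right_distributive ss_mul ss_add.
Proof.
move=> f g h; apply: skew_seriesP => n /=.
by rewrite -big_split; apply: eq_bigr => i _; rewrite raddfD mulrDr.
Qed.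

HB.instance Definition _ := GRing.isPzRing.Build T
  ss_addA ss_addC ss_add0 ss_addN ss_mulA ss_mul1l ss_mul1r ss_mulDl ss_mulDr.

Lemma ss_monomM a b i j :
  ss_monom a i * ss_monom b j = ss_monom (a * iter i alpha b) (i + j)%N.
Proof.
apply: skew_seriesP => n /=.
have [lein|ltni] := leqP i n; last first.
  rewrite big1 => [|k _]; first by case: eqP => //; lia.
  by case: eqP; [have := ltn_ord k; lia | rewrite mul0r].
rewrite (bigD1 (Ordinal (lein : i < n.+1)%N)) //= eqxx big1 => [|k neki].
  rewrite addr0; have -> : (n - i == j)%N = (n == i + j)%N by lia.
  by case: eqP; rewrite ?raddf0 ?mulr0.
by rewrite -val_eqE /= in neki; rewrite (negPf neki) mul0r.
Qed.

Definition ss_finite : {pred T} :=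
  [pred f : T | `[< exists d, forall n, (d <= n)%N -> f n = 0 >]].

Fact ss_finite_subring : subring_closed ss_finite.
Proof.
split=> [|f g /asboolP[d fd] /asboolP[e ge]|f g /asboolP[d fd] /asboolP[e ge]].
- by apply/asboolP; exists 1%N => -[].
- apply/asboolP; exists (maxn d e) => n; rewrite geq_max => /andP[dn en].
  by change (f n - g n = 0); rewrite fd ?ge ?subr0.
apply/asboolP; exists (d + e)%N => n den.
apply: big1 => i _; have [/fd->|ltid] := leqP d i; first by rewrite mul0r.
by rewrite ge ?raddf0 ?mulr0 //; lia.
Qed.

End SkewSeries.
Arguments ss_finite {R} alpha.

(* R[x; alpha], as the subring of R[[x; alpha]] of finitely supported series. *)
Record skew_poly (R : pzRingType) (alpha : {rmorphism R -> R}) := SkewPoly {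
  sp_val :> skew_series alpha;
  _ : sp_val \in ss_finite alpha
}.

Section SkewPoly.
Variables (R : pzRingType) (alpha : {rmorphism R -> R}).

HB.instance Definition _ := [isSub for @sp_val R alpha].
HB.instance Definition _ := [Choice of skew_poly alpha by <:].
HB.instance Definition _ := GRing.SubChoice_isSubPzRing.Build
  (skew_series alpha) (ss_finite alpha) (skew_poly alpha)
  (@ss_finite_subring R alpha).

End SkewPoly.

Section AutPower.
Variables (R : pzRingType) (alpha : {rmorphism R -> R}).
Variable alphaB : bijective alpha.

Fact aut_inv_ex : exists beta, cancel alpha beta /\ cancel beta alpha.
Proof. by case: alphaB => beta ab ba; exists beta. Qed.
Definition aut_inv : R -> R := projT1 (cid aut_inv_ex).
Lemma autK : cancel alpha aut_inv.
Proof. by rewrite /aut_inv; case: cid => ? []. Qed.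
Lemma autVK : cancel aut_inv alpha.
Proof. by rewrite /aut_inv; case: cid => ? []. Qed.

Definition autz (i : int) : R -> R :=
  match i with
  | Posz n => iter n alpha
  | Negz n => iter n.+1 aut_inv
  end.

Fact autzS i x : autz (i + 1) x = alpha (autz i x).
Proof.
case: i => [n|[|n]]; first by rewrite -PoszD addn1.
  by rewrite /= autVK.
have -> : Negz n.+1 + 1 = Negz n by rewrite !NegzE; lia.
by rewrite /= autVK.
Qed.
Fact autzD i j x : autz (i + j) x = autz i (autz j x).
Proof.
elim: i x => [|n IH|n IH] x; first by rewrite add0r.
  by rewrite -addn1 PoszD addrAC !autzS IH.
apply: (can_inj autK); rewrite -!autzS.
rewrite (_ : - n.+1%:Z + j + 1 = - n%:Z + j); last by lia.
by rewrite (_ : - n.+1%:Z + 1 = - n%:Z) ?IH //; lia.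
Qed.
Fact aut_invB : additive aut_inv.
Proof. by move=> x y; apply: (can_inj autK); rewrite rmorphB !autVK. Qed.
Fact aut_invM : monoid_morphism aut_inv.
Proof.
split=> [|x y]; apply: (can_inj autK); rewrite autVK ?rmorph1 //.
by rewrite rmorphM !autVK.
Qed.
Fact autzB i : additive (autz i).
Proof.
case: i => n; first exact: iter_rmorphB.
rewrite /autz; elim: n.+1 => // k IH x y.
by rewrite !iterS IH aut_invB.
Qed.
Fact autzM i : monoid_morphism (autz i).
Proof.
case: i => n; first exact: iter_rmorphM.
rewrite /autz; elim: n.+1 => // k [IH1 IHM]; split=> [|x y].
  by rewrite iterS IH1 aut_invM.1.
by rewrite !iterS IHM aut_invM.2.
Qed.
HB.instance Definition _ i := GRing.isZmodMorphism.Build R R (autz i) (@autzB i).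
HB.instance Definition _ i := GRing.isMonoidMorphism.Build R R (autz i) (@autzM i).

End AutPower.

(* R[[x, x^-1; alpha]] for an automorphism alpha, all coefficients being      *)
(* written on the left: f stands for \sum_(i >= -p) (f i) x^i. A term         *)
(* x^-i w is therefore represented by the coefficient alpha^-i(w) at -i.      *)
Record skew_laurent_series (R : pzRingType) (alpha : {rmorphism R -> R})
    (alphaB : bijective alpha) := SkewLaurentSeries {
  lcoef :> int -> R;
  _ : exists p : nat, forall i : int, i < - p%:Z -> lcoef i = 0
}.

Section SkewLaurentSeries.
Variables (R : pzRingType) (alpha : {rmorphism R -> R}).
Variable alphaB : bijective alpha.
Local Notation T := (skew_laurent_series alphaB).
Implicit Types (f g h : T) (a b : R).

HB.instance Definition _ := gen_eqMixin T.
HB.instance Definition _ := gen_choiceMixin T.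

Lemma skew_laurent_seriesP f g : f =1 g -> f = g.
Proof.
case: f g => [f fP] [g gP] /= /funext efg; rewrite efg in fP *.
by congr SkewLaurentSeries; apply: Prop_irrelevance.
Qed.

Fact ls_bound f : exists p : nat, forall i : int, i < - p%:Z -> f i = 0.
Proof. by case: f. Qed.

Fact ls_zero_subproof : exists p : nat, forall i : int, i < - p%:Z -> 0 = 0 :> R.
Proof. by exists 0%N. Qed.
Definition ls_zero : T := SkewLaurentSeries alphaB ls_zero_subproof.

Fact ls_opp_subproof f :
  exists p : nat, forall i : int, i < - p%:Z -> - f i = 0.
Proof. by have [p fp] := ls_bound f; exists p => i /fp->; rewrite oppr0. Qed.
Definition ls_opp f : T := SkewLaurentSeries alphaB (ls_opp_subproof f).

Fact ls_add_subproof f g :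
  exists p : nat, forall i : int, i < - p%:Z -> f i + g i = 0.
Proof.
have [p fp] := ls_bound f; have [q gq] := ls_bound g.
by exists (p + q)%N => i ltip; rewrite fp ?gq ?addr0 //; lia.
Qed.
Definition ls_add f g : T := SkewLaurentSeries alphaB (ls_add_subproof f g).

Fact ls_monom_subproof a (j : int) :
  exists p : nat, forall i : int, i < - p%:Z -> (if i == j then a else 0) = 0.
Proof. by exists `|j|%N => i ltip; case: eqP => //; lia. Qed.
Definition ls_monom a j : T := SkewLaurentSeries alphaB (ls_monom_subproof a j).

(* This sum has finite support, see ls_mul_coefE.                             *)
Definition ls_mul_coef f g (n : int) : R :=
  \sum_(i \in [set: int]) f i * autz alphaB i (g (n - i)).

Lemma ls_mul_coefE f g (p q N : nat) (n : int) :
  (forall i : int, i < - p%:Z -> f i = 0) ->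
  (forall i : int, i < - q%:Z -> g i = 0) ->
  n + p%:Z + q%:Z < N%:Z ->
  ls_mul_coef f g n = \sum_(i < N) f (i%:Z - p%:Z) *
    autz alphaB (i%:Z - p%:Z) (g (n - (i%:Z - p%:Z))).
Proof.
move=> fp gq ltN.
rewrite /ls_mul_coef (fsbigE [seq i%:Z - p%:Z | i <- iota 0 N]) //=.
- rewrite big_map -{1}(subn0 N) -/(index_iota 0 N) big_mkord.
  by apply: eq_bigl => i; rewrite in_setT.
- by rewrite map_inj_uniq ?iota_uniq // => i j; lia.
move=> i _ ini; have [/fp->|leip] := ltrP i (- p%:Z); first by rewrite mul0r.
rewrite gq ?raddf0 ?mulr0 //; apply: contraNlt ini => leq.
by apply/mapP; exists (absz (i + p%:Z)); [rewrite mem_iota; lia | lia].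
Qed.

Fact ls_mul_subproof f g :
  exists p : nat, forall i : int, i < - p%:Z -> ls_mul_coef f g i = 0.
Proof.
have [p fp] := ls_bound f; have [q gq] := ls_bound g.
exists (p + q)%N => n ltn.
by rewrite (@ls_mul_coefE f g p q 0%N) ?big_ord0 //; lia.
Qed.
Definition ls_mul f g : T := SkewLaurentSeries alphaB (ls_mul_subproof f g).

Fact ls_addA : associative ls_add.
Proof. by move=> f g h; apply: skew_laurent_seriesP => n /=; rewrite addrA. Qed.
Fact ls_addC : commutative ls_add.
Proof. by move=> f g; apply: skew_laurent_seriesP => n /=; rewrite addrC. Qed.
Fact ls_add0 : left_id ls_zero ls_add.
Proof. by move=> f; apply: skew_laurent_seriesP => n /=; rewrite add0r. Qed.
Fact ls_addN : left_inverse ls_zero ls_opp ls_add.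
Proof. by move=> f; apply: skew_laurent_seriesP => n /=; rewrite addNr. Qed.

Fact ls_mulA : associative ls_mul.
Proof.
move=> f g h; apply: skew_laurent_seriesP => n.
have [p fp] := ls_bound f; have [q gq] := ls_bound g.
have [r hr] := ls_bound h.
pose N := (absz (n + p%:Z + q%:Z + r%:Z)).+1.
have ltN : n + p%:Z + q%:Z + r%:Z < N%:Z by rewrite /N; lia.
have fgp i : i < - (p + q)%N%:Z -> ls_mul f g i = 0.
  by move=> ltip /=; rewrite (@ls_mul_coefE f g p q 0%N) ?big_ord0 //; lia.
have ghq i : i < - (q + r)%N%:Z -> ls_mul g h i = 0.
  by move=> ltip /=; rewrite (@ls_mul_coefE g h q r 0%N) ?big_ord0 //; lia.
pose F (i j : int) := f (i - p%:Z) * autz alphaB (i - p%:Z) (g (j - q%:Z)) *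
  autz alphaB (i + j - (p%:Z + q%:Z)) (h (n - (i + j - (p%:Z + q%:Z)))).
transitivity (\sum_(i < N) \sum_(j < N) F i j).
  rewrite /= (@ls_mul_coefE f (ls_mul g h) p (q + r) N) //; last by lia.
  apply: eq_bigr => i _; rewrite /= (@ls_mul_coefE g h q r N) //; last by lia.
  rewrite rmorph_sum mulr_sumr; apply: eq_bigr => j _.
  rewrite rmorphM /= mulrA -autzD /F; congr (_ * autz _ _ (h _)); lia.
transitivity (\sum_(i < N) \sum_(k < N) F i (k%:Z - i%:Z)); last first.
  rewrite /= (@ls_mul_coefE (ls_mul f g) h (p + q) r N) //; last by lia.
  rewrite exchange_big; apply: eq_bigr => k _ /=.
  rewrite (@ls_mul_coefE f g p q N) //; last by have := ltn_ord k; lia.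
  rewrite mulr_suml; apply: eq_bigr => i _.
  rewrite /F.
  rewrite (_ : k%:Z - i%:Z - q%:Z = k%:Z - (p + q)%N%:Z - (i%:Z - p%:Z));
    last by lia.
  by rewrite (_ : i%:Z + (k%:Z - i%:Z) - _ = k%:Z - (p + q)%N%:Z) //; lia.
apply: eq_bigr => -[i ltiN] _ /=.
rewrite -(big_mkord predT (fun j : nat => F i j)).
rewrite -(big_mkord predT (fun k : nat => F i (k%:Z - i%:Z))).
rewrite [RHS](big_cat_nat (n := i)) //=; last by lia.
rewrite [X in _ = X + _]big_nat_cond [X in _ = X + _]big1 ?add0r; last first.
  by move=> k kP; rewrite /F gq ?raddf0 ?mulr0 ?mul0r //; lia.
rewrite -[X in _ = \sum_(X <= _ < _ | _) _]add0n big_addn.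
rewrite [LHS](big_cat_nat (n := (N - i)%N)) //=; last by lia.
rewrite [X in _ + X]big_nat_cond [X in _ + X]big1 ?addr0; last first.
  by move=> k kP; rewrite /F hr ?raddf0 ?mulr0 //; lia.
by apply: eq_bigr => k _; congr (F _ _); lia.
Qed.

Lemma ls_monomM_coef a (i : int) g (n : int) :
  ls_mul (ls_monom a i) g n = a * autz alphaB i (g (n - i)).
Proof.
rewrite /= /ls_mul_coef (fsbigE [:: i]) //=.
  by rewrite big_cons big_nil in_setT addr0 /= eqxx.
by move=> j _; rewrite inE => /negPf->; rewrite mul0r.
Qed.

Fact ls_mul1l : left_id (ls_monom 1 0) ls_mul.
Proof.
by move=> f; apply: skew_laurent_seriesP => n; rewrite ls_monomM_coef mul1r subr0.
Qed.
Fact ls_mul1r : right_id (ls_monom 1 0) ls_mul.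
Proof.
move=> f; apply: skew_laurent_seriesP => n.
rewrite /= /ls_mul_coef (fsbigE [:: n]) //=.
  by rewrite big_cons big_nil in_setT addr0 /= subrr eqxx rmorph1 mulr1.
move=> j _; rewrite inE => nej.
by rewrite subr_eq0 eq_sym (negPf nej) raddf0 mulr0.
Qed.
Fact ls_mulDl : left_distributive ls_mul ls_add.
Proof.
move=> f g h; apply: skew_laurent_seriesP => n /=.
have [p fp] := ls_bound f; have [q gq] := ls_bound g.
have [r hr] := ls_bound h.
pose N := (absz (n + p%:Z + q%:Z + r%:Z)).+1.
have fP i : i < - (p + q)%N%:Z -> f i = 0 by move=> ltip; rewrite fp //; lia.
have gP i : i < - (p + q)%N%:Z -> g i = 0 by move=> ltip; rewrite gq //; lia.
have fgP i : i < - (p + q)%N%:Z -> ls_add f g i = 0.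
  by move=> ltip /=; rewrite fP ?gP ?addr0.
rewrite !(@ls_mul_coefE _ h (p + q) r N) //; try by rewrite /N; lia.
by rewrite -big_split; apply: eq_bigr => i _; rewrite mulrDl.
Qed.
Fact ls_mulDr : right_distributive ls_mul ls_add.
Proof.
move=> h f g; apply: skew_laurent_seriesP => n /=.
have [p fp] := ls_bound f; have [q gq] := ls_bound g.
have [r hr] := ls_bound h.
pose N := (absz (n + p%:Z + q%:Z + r%:Z)).+1.
have fP i : i < - (p + q)%N%:Z -> f i = 0 by move=> ltip; rewrite fp //; lia.
have gP i : i < - (p + q)%N%:Z -> g i = 0 by move=> ltip; rewrite gq //; lia.
have fgP i : i < - (p + q)%N%:Z -> ls_add f g i = 0.
  by move=> ltip /=; rewrite fP ?gP ?addr0.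
rewrite !(@ls_mul_coefE h _ r (p + q) N) //; try by rewrite /N; lia.
by rewrite -big_split; apply: eq_bigr => i _; rewrite raddfD mulrDr.
Qed.

HB.instance Definition _ := GRing.isPzRing.Build T
  ls_addA ls_addC ls_add0 ls_addN ls_mulA ls_mul1l ls_mul1r ls_mulDl ls_mulDr.

Lemma ls_monomM a b i j :
  ls_monom a i * ls_monom b j = ls_monom (a * autz alphaB i b) (i + j).
Proof.
apply: skew_laurent_seriesP => n; rewrite [LHS]ls_monomM_coef /=.
rewrite subr_eq (addrC j).
by case: ifP => // _; rewrite raddf0 mulr0.
Qed.

(* T is the localization of R[[x; alpha]] at the powers of x: ls_of_series is *)
(* an injective morphism, it sends each x^n to a unit (ls_Xn_unit), and every *)
(* element of T is some x^-p g with g a power series (ls_fraction).           *)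
Fact ls_of_series_subproof (f : skew_series alpha) :
  exists p : nat, forall i : int, i < - p%:Z ->
    (if i is Posz n then f n else 0) = 0.
Proof. by exists 0%N => -[]. Qed.
Definition ls_of_series (f : skew_series alpha) : T :=
  SkewLaurentSeries alphaB (ls_of_series_subproof f).

Fact ls_of_seriesB : additive ls_of_series.
Proof.
move=> f g; apply: skew_laurent_seriesP => -[] n //=.
by change (0 = 0 - 0 :> R); rewrite subr0.
Qed.
Fact ls_of_seriesM : monoid_morphism ls_of_series.
Proof.
split=> [|f g]; apply: skew_laurent_seriesP; first by case.
have P0 (k : skew_series alpha) i : i < - 0%N%:Z -> ls_of_series k i = 0.
  by case: i.
case=> n; last first.
  rewrite [RHS](@ls_mul_coefE _ _ 0%N 0%N 0%N); [|exact: P0..|by []].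
  by rewrite big_ord0.
rewrite [RHS](@ls_mul_coefE _ _ 0%N 0%N n.+1); [|exact: P0..|by lia].
apply: eq_bigr => i _; rewrite subr0 /=.
by rewrite (_ : n%:Z - i%:Z = (n - i)%N%:Z) //; have := ltn_ord i; lia.
Qed.
HB.instance Definition _ :=
  GRing.isZmodMorphism.Build (skew_series alpha) T ls_of_series ls_of_seriesB.
HB.instance Definition _ :=
  GRing.isMonoidMorphism.Build (skew_series alpha) T ls_of_series ls_of_seriesM.

Lemma ls_of_series_inj : injective ls_of_series.
Proof.
move=> f g efg; apply: skew_seriesP => n.
by have /(congr1 (fun u : T => u n%:Z)) := efg.
Qed.

Lemma ls_of_series_monom a n : ls_of_series (ss_monom alpha a n) = ls_monom a n%:Z.
Proof. by apply: skew_laurent_seriesP => -[]. Qed.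

Lemma ls_Xn_unit (n : nat) :
  ls_monom 1 n%:Z * ls_monom 1 (- n%:Z) = 1 /\
  ls_monom 1 (- n%:Z) * ls_monom 1 n%:Z = 1.
Proof. by rewrite !ls_monomM !rmorph1 !mulr1 subrr addNr. Qed.

Lemma ls_fractionE f (p : nat) : (forall i : int, i < - p%:Z -> f i = 0) ->
  f = ls_monom 1 (- p%:Z) * ls_of_series
    (SkewSeries alpha (fun n => autz alphaB p%:Z (f (n%:Z - p%:Z)))).
Proof.
move=> fp; apply: skew_laurent_seriesP => i.
rewrite [RHS]ls_monomM_coef mul1r opprK.
case eip: (i + p%:Z) => [n|n] /=; last by rewrite raddf0 fp //; lia.
rewrite -[iter p alpha]/(autz alphaB p%:Z) -autzD addNr.
by rewrite (_ : n%:Z - p%:Z = i) //; lia.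
Qed.

Lemma ls_fraction f :
  exists (p : nat) (g : skew_series alpha), f = ls_monom 1 (- p%:Z) * ls_of_series g.
Proof.
by have [p /ls_fractionE eqf] := ls_bound f; exists p; eexists; apply: eqf.
Qed.

Definition ls_finite : {pred T} :=
  [pred f : T | `[< exists d : nat, forall i : int, d%:Z < `|i| -> f i = 0 >]].

Fact ls_finite_subring : subring_closed ls_finite.
Proof.
split=> [|f g /asboolP[d fd] /asboolP[e ge]|f g /asboolP[d fd] /asboolP[e ge]].
- by apply/asboolP; exists 0%N => -[[]|].
- apply/asboolP; exists (maxn d e) => n ltn.
  by change (f n - g n = 0); rewrite fd ?ge ?subr0 //; lia.
apply/asboolP; exists (d + e)%N => n den.
change (ls_mul_coef f g n = 0); apply: fsbig1 => i _.
have [/fd->|leid] := ltrP d%:Z `|i|; first by rewrite mul0r.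
by rewrite ge ?raddf0 ?mulr0 //; lia.
Qed.

(* In particular ls_finite consists of the finite sums of terms x^-i w x^j.    *)
Lemma ls_finiteP f : f \in ls_finite <->
  exists (p : nat) (g : skew_series alpha),
    g \in ss_finite alpha /\ f = ls_monom 1 (- p%:Z) * ls_of_series g.
Proof.
split=> [/asboolP[d fd]|[p [g [/asboolP[d gd] ->]]]].
  exists d; eexists; split; last by apply: ls_fractionE => i ltid; apply: fd; lia.
  by apply/asboolP; exists (d + d).+1 => n ltn /=; rewrite fd ?raddf0 //; lia.
apply/asboolP; exists (p + d)%N => i ltpd.
rewrite [LHS]ls_monomM_coef mul1r opprK.
by case eip: (i + p%:Z) => [n|n] /=; rewrite ?gd ?raddf0 //; lia.
Qed.

End SkewLaurentSeries.
Arguments ls_finite {R alpha} alphaB.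

(* R[x, x^-1; alpha], as the subring of R[[x, x^-1; alpha]] of finitely       *)
(* supported series.                                                          *)
Record skew_laurent_poly (R : pzRingType) (alpha : {rmorphism R -> R})
    (alphaB : bijective alpha) := SkewLaurentPoly {
  lp_val :> skew_laurent_series alphaB;
  _ : lp_val \in ls_finite alphaB
}.

Section SkewLaurentPoly.
Variables (R : pzRingType) (alpha : {rmorphism R -> R}).
Variable alphaB : bijective alpha.

HB.instance Definition _ := [isSub for @lp_val R alpha alphaB].
HB.instance Definition _ := [Choice of skew_laurent_poly alphaB by <:].
HB.instance Definition _ := GRing.SubChoice_isSubPzRing.Build
  (skew_laurent_series alphaB) (ls_finite alphaB) (skew_laurent_poly alphaB)
  (@ls_finite_subring R alpha alphaB).

End SkewLaurentPoly.

Definition SPA (R : pzRingType) (alpha : {rmorphism R -> R}) : Prop :=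
  forall g h : skew_series alpha,
    g * h = 0 <-> forall i j : nat, g i * h j = 0.

(* Main.v *)
Require Import Defs.
From mathcomp Require Import all_boot all_order all_algebra.
From mathcomp Require Import classical_sets zify.

(** Nil-reversibility passes down along injective ring morphisms, and
    constants embed [R] in each of the four extensions, while the skew Laurent
    series ring contains the three others. So the only implication with
    content is that [R] nil-reversible makes [R[[x, x^-1; alpha]]]
    nil-reversible.

    For that, the Armendariz condition is first carried to Laurent series
    ([ls_mul_eq0]): [f * g = 0] if and only if all products [f i * g j] vanish.
    Multiplying by powers of [x] turns [f] and [g] into power series; this
    twists the coefficients by powers of [alpha], which is harmless because the
    condition, read on monomials, says that [alpha] does not affect the
    vanishing of products ([SPA_compatible]). Used repeatedly on a power of a
    nilpotent [f], the condition shows that every coefficient of [f] is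
    nilpotent ([ls_coef_nilpotent]). Then [f * g = 0] and [g * f = 0] are
    respectively equivalent to the vanishing of all [f i * g j] and of all
    [g j * f i], and these are equivalent to each other in [R]. *)

Set Implicit Arguments.
Unset Strict Implicit.
Unset Printing Implicit Defensive.

Import GRing.Theory.
Local Open Scope ring_scope.

Lemma nil_reversibleP (A : pzRingType) : nil_reversible A <->
  forall a x : A, nilpotents a -> x * a = 0 <-> a * x = 0.
Proof.
split=> [revA a x nila|revA a nila].
  by have := congr1 (fun S => S x) (revA a nila); rewrite /lann /rann /= => ->.
by apply/seteqP; split=> x /= /(revA a x nila).
Qed.

Lemma nil_reversible_inj (A B : pzRingType) (phi : A -> B) :
  injective phi -> phi 0 = 0 -> monoid_morphism phi ->
  nil_reversible B -> nil_reversible A.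
Proof.
move=> phi_inj phi0 [phi1 phiM] /nil_reversibleP revB.
apply/nil_reversibleP => a x [n an0].
have phiX k : phi (a ^+ k) = phi a ^+ k.
  by elim: k => [|k IH]; rewrite ?phi1 // !exprS phiM IH.
have nilphi : nilpotents (phi a) by exists n; rewrite -phiX an0.
have phi_eq0 y : phi y = 0 <-> y = 0.
  by split=> [phiy0|->//]; apply: phi_inj; rewrite phiy0 phi0.
by rewrite -phi_eq0 -(phi_eq0 (a * x)) !phiM; apply: revB.
Qed.

Section SkewExtensions.
Variables (R : pzRingType) (alpha : {rmorphism R -> R}).
Variable alphaB : bijective alpha.

(** * Embeddings between the extensions *)

Lemma ls_const_morphism : monoid_morphism (fun a => ls_monom alphaB a 0).
Proof. by split=> // a b; rewrite ls_monomM. Qed.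

Lemma ls_const0 : ls_monom alphaB 0 0 = 0.
Proof. by apply: skew_laurent_seriesP => i /=; case: eqP. Qed.

Lemma ls_const_inj : injective (fun a => ls_monom alphaB a 0).
Proof.
by move=> a b /(congr1 (fun f : skew_laurent_series alphaB => f 0)) /=.
Qed.

Lemma ls_const_finite a : ls_monom alphaB a 0 \in ls_finite alphaB.
Proof. by apply/boolp.asboolP; exists 0%N => i lti /=; case: eqP => //; lia. Qed.

Definition lp_const a : skew_laurent_poly alphaB :=
  SkewLaurentPoly (ls_const_finite a).

Lemma lp_const_inj : injective lp_const.
Proof. by move=> a b /(congr1 val) /ls_const_inj. Qed.

Lemma lp_const0 : lp_const 0 = 0.
Proof. by apply: val_inj; rewrite /= ls_const0. Qed.

Lemma lp_const_morphism : monoid_morphism lp_const.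
Proof.
split=> [|a b]; apply: val_inj; first by rewrite rmorph1.
by rewrite rmorphM /= ls_monomM.
Qed.

Lemma ss_const_finite a : ss_monom alpha a 0 \in ss_finite alpha.
Proof. by apply/boolp.asboolP; exists 1%N => -[]. Qed.

Definition sp_const a : skew_poly alpha := SkewPoly (ss_const_finite a).

Lemma sp_const_inj : injective sp_const.
Proof.
by move=> a b /(congr1 (fun f : skew_poly alpha => (val f : _ -> _) 0%N)) /=.
Qed.

Lemma sp_const0 : sp_const 0 = 0.
Proof. by apply: val_inj; apply: skew_seriesP => -[]. Qed.

Lemma sp_const_morphism : monoid_morphism sp_const.
Proof.
split=> [|a b]; apply: val_inj; first by rewrite rmorph1.
by rewrite rmorphM /= ss_monomM.
Qed.

(** * The Armendariz condition on Laurent series *)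

Hypothesis spaR : SPA alpha.

Lemma ss_monom_eq0 a i : ss_monom alpha a i = 0 <-> a = 0.
Proof.
split=> [/(congr1 (fun f : skew_series alpha => f i))|->] /=.
  by rewrite eqxx.
by apply: skew_seriesP => n /=; case: eqP.
Qed.

(** The Armendariz condition for the monomials [a x^i] and [b], since their
    product is [a alpha^i(b) x^i]. *)
Lemma SPA_compatible a b i : a * iter i alpha b = 0 <-> a * b = 0.
Proof.
rewrite -(ss_monom_eq0 _ (i + 0)) -ss_monomM spaR.
split=> [/(_ i 0%N)|ab0 m n] /=; first by rewrite eqxx.
by case: eqP; case: eqP; rewrite ?mul0r ?mulr0.
Qed.

(** This is [x^p (f g) x^q = (x^p f) (g x^q)] read at degree [n]; the bounds on
    [f] and [g] make both factors on the right power series. *)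
Lemma ls_mul_shift (f g : skew_laurent_series alphaB) (p q n : nat) :
  (forall i : int, (i < - p%:Z)%R -> f i = 0) ->
  (forall i : int, (i < - q%:Z)%R -> g i = 0) ->
  iter p alpha ((f * g) (n%:Z - p%:Z - q%:Z)) =
  (SkewSeries alpha (fun k => iter p alpha (f (k%:Z - p%:Z))) *
   SkewSeries alpha (fun k => g (k%:Z - q%:Z))) n.
Proof.
move=> fp gq; rewrite [(f * g) _](ls_mul_coefE (N := n.+1) fp gq); last by lia.
rewrite rmorph_sum /=; apply: eq_bigr => i _; rewrite rmorphM /=; congr (_ * _).
rewrite -![iter _ alpha _]/(autz alphaB _%:Z _) -autzD.
by congr (autz _ _ (g _)); have := ltn_ord i; lia.
Qed.

Lemma iter_aut_eq0 p a : iter p alpha a = 0 <-> a = 0.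
Proof.
split=> [|->]; last by rewrite raddf0.
by rewrite -[_ a]mul1r SPA_compatible mul1r.
Qed.

Lemma ls_mul_eq0 (f g : skew_laurent_series alphaB) :
  f * g = 0 <-> forall i j, f i * g j = 0.
Proof.
have [p fp] := ls_bound f; have [q gq] := ls_bound g.
pose F := SkewSeries alpha (fun k => iter p alpha (f (k%:Z - p%:Z))).
pose G := SkewSeries alpha (fun k => g (k%:Z - q%:Z)).
have FGE : f * g = 0 <-> F * G = 0.
  split=> [fg0|FG0].
    by apply: skew_seriesP => n; rewrite -ls_mul_shift // fg0 raddf0.
  apply: skew_laurent_seriesP => i.
  case ei: (i + p%:Z + q%:Z) => [n|n]; last first.
    rewrite [LHS](ls_mul_coefE (N := 0) fp gq) ?big_ord0 //.
    by rewrite ei.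
  rewrite (_ : i = n%:Z - p%:Z - q%:Z); last by lia.
  by apply/(iter_aut_eq0 p); rewrite ls_mul_shift // -/F -/G FG0.
rewrite {}FGE spaR; split=> [FG0 i j|fg0 m n]; last first.
  by rewrite /= -(SPA_compatible _ _ p) -rmorphM fg0 raddf0.
case ei: (i + p%:Z) => [m|m]; last by rewrite fp ?mul0r //; lia.
case ej: (j + q%:Z) => [n|n]; last by rewrite gq ?mulr0 //; lia.
apply/(iter_aut_eq0 p); rewrite rmorphM SPA_compatible.
by have /= := FG0 m n; rewrite -ei -ej !addrK.
Qed.

(** * Nilpotent Laurent series *)

(** The factor [c] makes the induction work: each step moves one coefficient
    [f i] of the leftmost factor of [f ^+ n] into it. *)
Lemma ls_coef_exp (f : skew_laurent_series alphaB) n c i :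
  (forall j, c * (f ^+ n) j = 0) -> c * f i ^+ n = 0.
Proof.
elim: n c => [|n IH] c cfn0; first by have := cfn0 0.
rewrite exprS mulrA; apply: IH => j.
have /ls_mul_eq0/(_ i j) : (ls_monom alphaB c 0 * f) * f ^+ n = 0.
  rewrite -mulrA -exprS; apply: skew_laurent_seriesP => k.
  by rewrite [LHS]ls_monomM_coef subr0; apply: cfn0.
by rewrite [(_ * f) i]ls_monomM_coef subr0.
Qed.

Lemma ls_coef_nilpotent (f : skew_laurent_series alphaB) i :
  nilpotents f -> nilpotents (f i).
Proof.
move=> [n fn0]; exists n; rewrite -[LHS]mul1r.
by apply: ls_coef_exp => j; rewrite fn0 mulr0.
Qed.

Lemma nil_reversible_laurent_series :
  nil_reversible R -> nil_reversible (skew_laurent_series alphaB).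
Proof.
move=> /nil_reversibleP revR; apply/nil_reversibleP => f g nilf.
rewrite !ls_mul_eq0.
by split=> fg0 i j; apply/(revR _ _ (ls_coef_nilpotent _ nilf)).
Qed.

End SkewExtensions.

Theorem proposition3p15 (R : pzRingType) (alpha : {rmorphism R -> R})
    (alphaB : bijective alpha) (spaR : SPA alpha) :
  [<-> nil_reversible R;
       nil_reversible (skew_poly alpha);
       nil_reversible (skew_laurent_poly alphaB);
       nil_reversible (skew_series alpha);
       nil_reversible (skew_laurent_series alphaB)].
Proof.
have base_ls := @nil_reversible_laurent_series R alpha alphaB spaR.
have ls_ss : nil_reversible (skew_laurent_series alphaB) ->
    nil_reversible (skew_series alpha).
  exact: nil_reversible_inj (@ls_of_series_inj R alpha alphaB)
    (raddf0 _) (@ls_of_seriesM R alpha alphaB).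
have ss_sp : nil_reversible (skew_series alpha) ->
    nil_reversible (skew_poly alpha).
  apply: (@nil_reversible_inj _ _ (val : skew_poly alpha -> _)).
  - exact: val_inj.
  - exact: raddf0.
  - by split=> [|f g]; rewrite ?rmorph1 ?rmorphM.
have ls_lp : nil_reversible (skew_laurent_series alphaB) ->
    nil_reversible (skew_laurent_poly alphaB).
  apply: (@nil_reversible_inj _ _ (val : skew_laurent_poly alphaB -> _)).
  - exact: val_inj.
  - exact: raddf0.
  - by split=> [|f g]; rewrite ?rmorph1 ?rmorphM.
have sp_base := nil_reversible_inj (@sp_const_inj R alpha)
  (sp_const0 alpha) (sp_const_morphism alpha).
have lp_base := nil_reversible_inj (@lp_const_inj R alpha alphaB)
  (lp_const0 alphaB) (lp_const_morphism alphaB).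
by tfae; auto.
Qed.
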